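(* Assume that there exist a continuous function $\lambda:\mathbb{X}\to\mathbb{R}$ and a value $c\in\mathbb{R}$ such that $$\lambda(f(x,u))\le\lambda(x)+\ell(x,u)-c\qquad\forall\,(x,u)\in\mathbb{Z}.$$ Assume moreover that there exists a nonempty set $N\subset\mathbb{X}$ such that for any $\psi:\mathbb{X}\to\mathbb{R}$ with $\psi\ge-\lambda$ on $\mathbb{X}$ and $\psi(x)=-\lambda(x)$ for all $x\in N$ we have $T\psi(x)=c-\lambda(x)$ for all $x\in N$. Let $\psi^0:=-\lambda$ and assume that there is $M>0$ with $T^k\psi^0\le M+ck$ on $\mathbb{X}$ for all $k\in\mathbb{N}$. Then the sequence of functions $\psi^k:=(\hat{T}^k\psi^0)^n$, $k\in\mathbb{N}$, converges pointwise to a solution of the shifted Bellman Equation, i.e. to a function $\psi^\infty:\mathbb{X}\to\mathbb{R}$ such that $T\psi^\infty=\psi^\infty+c'$ for some constant $c'\in\mathbb{R}$.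
   Context: Setting. $\mathbb{X}\subset\mathbb{R}^n$ is a nonempty compact set, $\mathbb{Z}\subset\mathbb{X}\times\mathbb{R}^m$ is compact, $f:\mathbb{Z}\to\mathbb{X}$ and $\ell:\mathbb{Z}\to\mathbb{R}$ are continuous. For $x\in\mathbb{X}$, $\mathbb{U}(x):=\{u\in\mathbb{R}^m:(x,u)\in\mathbb{Z}\}$ is nonempty, and $f(x,u)\in\mathbb{X}$ for all $u\in\mathbb{U}(x)$; the set-valued map $\mathbb{U}(\cdot)$ is upper semicontinuous. $\mathcal{C}(\mathbb{X})$ is the set of continuous functions $\mathbb{X}\to\mathbb{R}$. Operators. For $\psi:\mathbb{X}\to\mathbb{R}$ bounded from below, $T\psi(x):=\inf_{u\in\mathbb{U}(x)}[\ell(x,u)+\psi(f(x,u))]$ (a minimum when $\psi$ is lower semicontinuous); it is a standing assumption that $T$ maps $\mathcal{C}(\mathbb{X})$ into $\mathcal{C}(\mathbb{X})$. For $\psi_1,\psi_2\in\mathcal{C}(\mathbb{X})$, $c(\psi_1,\psi_2):=\frac12\max_{x\in\mathbb{X}}[\psi_1(x)-\psi_2(x)]+\frac12\min_{x\in\mathbb{X}}[\psi_1(x)-\psi_2(x)]$. The min-shifted Bellman operator $\hat T:\mathcal{C}(\mathbb{X})\to\mathcal{C}(\mathbb{X})$ is $\hat{T}\psi:=\min\{\psi,\,T\psi+c(\psi,T\psi)\}$ (pointwise minimum). Powers of operators denote iterates. Normalization: $\psi^n(x):=\psi(x)-\min_{y\in\mathbb{X}}\psi(y)$ (here the superscript $n$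 in $(\cdot)^n$ denotes this normalization, not a power). *)

(* Defs.v *)
From HB Require Import structures.
From mathcomp Require Import all_boot all_order all_algebra.
From mathcomp Require Import all_classical all_reals all_analysis.
Import Order.TTheory GRing.Theory Num.Theory.
Import numFieldNormedType.Exports.

Set Implicit Arguments.
Unset Strict Implicit.
Unset Printing Implicit Defensive.

Local Open Scope classical_set_scope.
Local Open Scope ring_scope.

(* A function on a subset (X of R^n, or Z of R^n x R^m) is represented by a
   function on the whole space of which only the values on that subset matter;
   its continuity is {within X, continuous _}.  Below, Z is a subset of
   X x R^m and f maps Z into X, so for x in X no operator reads a value taken
   outside X or Z. *)

Definition controls (R : realType) (n m : nat) (Z : set ('rV[R]_n * 'rV[R]_m))
    (x : 'rV[R]_n) : set 'rV[R]_m :=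
  [set u | Z (x, u)].

Definition usc_setmap (R : realType) (n m : nat) (X : set 'rV[R]_n)
    (F : 'rV[R]_n -> set 'rV[R]_m) : Prop :=
  forall x, X x -> forall V : set 'rV[R]_m, open V -> F x `<=` V ->
    \forall y \near within X (nbhs x), F y `<=` V.

Definition bounded_below_on (R : realType) (n : nat) (X : set 'rV[R]_n)
    (psi : 'rV[R]_n -> R) : Prop :=
  exists b : R, forall x, X x -> b <= psi x.

(* [inf] and [sup] are real-valued; they carry their usual meaning only on
   nonempty sets bounded on the relevant side.  For [bellman] this is the case
   when x is in X and psi is bounded below on X. *)
Definition bellman (R : realType) (n m : nat) (Z : set ('rV[R]_n * 'rV[R]_m))
    (f : 'rV[R]_n * 'rV[R]_m -> 'rV[R]_n) (l : 'rV[R]_n * 'rV[R]_m -> R)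
    (psi : 'rV[R]_n -> R) : 'rV[R]_n -> R :=
  fun x => inf [set l (x, u) + psi (f (x, u)) | u in controls Z x].

(* For psi1, psi2 continuous on the nonempty compact set X, the supremum and the
   infimum are attained: they are the maximum and the minimum over X. *)
Definition shift_const (R : realType) (n : nat) (X : set 'rV[R]_n)
    (psi1 psi2 : 'rV[R]_n -> R) : R :=
  2^-1 * sup [set psi1 x - psi2 x | x in X]
  + 2^-1 * inf [set psi1 x - psi2 x | x in X].

Definition min_shifted_bellman (R : realType) (n m : nat) (X : set 'rV[R]_n)
    (Z : set ('rV[R]_n * 'rV[R]_m))
    (f : 'rV[R]_n * 'rV[R]_m -> 'rV[R]_n) (l : 'rV[R]_n * 'rV[R]_m -> R)
    (psi : 'rV[R]_n -> R) : 'rV[R]_n -> R :=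
  fun x => Num.min (psi x)
    (bellman Z f l psi x + shift_const X psi (bellman Z f l psi)).

(* Likewise a minimum when psi is continuous on X. *)
Definition normalize (R : realType) (n : nat) (X : set 'rV[R]_n)
    (psi : 'rV[R]_n -> R) : 'rV[R]_n -> R :=
  fun x => psi x - inf [set psi y | y in X].

(* Boundedness from below puts psi in the domain of the Bellman operator;
   without it the equation could hold through the default value of [inf]. *)
Definition shifted_bellman_solution (R : realType) (n m : nat)
    (X : set 'rV[R]_n) (Z : set ('rV[R]_n * 'rV[R]_m))
    (f : 'rV[R]_n * 'rV[R]_m -> 'rV[R]_n) (l : 'rV[R]_n * 'rV[R]_m -> R)
    (psi : 'rV[R]_n -> R) : Prop :=
  bounded_below_on X psi /\
  exists c' : R, forall x, X x -> bellman Z f l psi x = psi x + c'.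

(* Main.v *)
Require Import Defs.
From mathcomp Require Import all_boot all_order all_algebra.
From mathcomp Require Import all_classical all_reals all_analysis.
From mathcomp Require Import lra.
Import Order.TTheory GRing.Theory Num.Theory.
Import numFieldNormedType.Exports.
Set Implicit Arguments.
Unset Strict Implicit.
Local Open Scope classical_set_scope.
Local Open Scope ring_scope.

(** Write [T] for the Bellman operator and [phi_k] for the [k]-th min-shifted
    iterate of [- lambda].

    The storage inequality says [T (- lambda) >= - lambda + c], and the
    hypothesis on [N] says that [T psi = psi + c] holds on [N] for every [psi]
    that lies above [- lambda] and touches it on [N].  Up to an additive
    constant, every [phi_k] is such a function, it still satisfies
    [T phi_k >= phi_k + c], and equality holds on [N].  Hence
    [max (phi_k - T phi_k) = - c] is attained on [N]; with
    [2 s_k = max (T phi_k - c - phi_k)] the shift constant is [- c - s_k], so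
    [phi_{k+1} = min (phi_k, T phi_k - c - s_k)]
    ([shift_const_admissible], [min_shifted_bellman_admissible]).

    Fix [x0] in [N].  Since [T phi_k x0 = phi_k x0 + c], the value at [x0] drops
    by exactly [s_k], and [psi_k = phi_k - phi_k x0] satisfies
    [psi_{k+1} = min (psi_k + s_k, T psi_k - c)].  As
    [0 <= T psi_k - c - psi_k <= 2 s_k], the increment [psi_{k+1} - psi_k] lies
    between one half and the whole of [T psi_k - c - psi_k].  So [psi_k] is a
    relaxed value iteration: it increases, and it stays below
    [T^k (- lambda) - c k + lambda x0], which is bounded by assumption.  Its
    pointwise limit [psi_oo] satisfies [T psi_oo = psi_oo + c], because the
    residuals are at most twice increments that tend to zero, and because [T]
    commutes with increasing limits of continuous functions by compactness of
    [Z] ([bellman_lim_le], [relaxed_value_iteration_cvg]).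

    Normalization removes the constants [phi_k x0]; the minima of [psi_k] form a
    bounded monotone sequence, so they converge too, and the limit of the
    normalized iterates differs from [psi_oo] by a constant. *)

(** * Infima and continuity on subsets *)

Lemma inf_image_shift (R : realType) (T : Type) (A : set T) (g h : T -> R) (a : R) :
  A !=set0 -> has_lbound [set g t | t in A] ->
  (forall t, A t -> h t = g t + a) ->
  inf [set h t | t in A] = inf [set g t | t in A] + a.
Proof.
move=> [t0 At0] [b lb_g] hE; apply/eqP; rewrite eq_le; apply/andP; split.
  rewrite -lerBlDr; apply: lb_le_inf; first by exists (g t0), t0.
  move=> _ [t At <-]; rewrite lerBlDr -hE//; apply: ge_inf; last by exists t.
  exists (b + a) => _ [u Au <-]; rewrite hE// lerD2r.
  by apply: lb_g; exists u.
apply: lb_le_inf; first by exists (h t0), t0.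
move=> _ [t At <-]; rewrite hE// lerD2r; apply: ge_inf; last by exists t.
by exists b.
Qed.

Lemma within_continuous_compose (T U V : topologicalType) (A : set T) (B : set U)
    (f : T -> U) (g : U -> V) :
  (forall t, A t -> B (f t)) -> {within A, continuous f} ->
  {within B, continuous g} -> {within A, continuous (g \o f)}.
Proof.
move=> fAB /subspace_continuousP fc /subspace_continuousP gc.
apply/subspace_continuousP => t At.
have : f s @[s --> within A (nbhs t)] --> within B (nbhs (f t)).
  move=> P /(fc _ At) fP.
  have {}fP : nbhs t [set s | A s -> B (f s) -> P (f s)] by exact: fP.
  suff: nbhs t [set s | A s -> P (f s)] by exact.
  by apply: filterS fP => s sP As; apply: sP => //; apply: fAB.
by move=> fB; apply: (cvg_trans _ (gc _ (fAB _ At))); apply: cvg_fmap2 fB.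
Qed.

Lemma within_continuous_compact_lbound (T : topologicalType) (R : realType)
    (A : set T) (g : T -> R) :
  compact A -> {within A, continuous g} -> exists b, forall t, A t -> b <= g t.
Proof.
move=> cA cg; have [[t At]|A0] := pselect (A !=set0).
  have [b _ hb] := compact_EVT_min (ex_intro _ t At) cA cg.
  by exists (g b) => s As; apply: hb; rewrite inE.
by exists 0 => t At; case: A0; exists t.
Qed.

(** * The Bellman operator *)

Section BellmanOperator.
Context {R : realType} {n m : nat}.
Context {X : set 'rV[R]_n} {Z : set ('rV[R]_n * 'rV[R]_m)}.
Context {f : 'rV[R]_n * 'rV[R]_m -> 'rV[R]_n} {l : 'rV[R]_n * 'rV[R]_m -> R}.
Hypothesis f_maps : forall z, Z z -> X (f z).
Hypothesis l_lb : exists b, forall z, Z z -> b <= l z.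
Hypothesis U_nonempty : forall x, X x -> controls Z x !=set0.

Notation T := (bellman Z f l).

Lemma bellman_has_lbound psi x : bounded_below_on X psi ->
  has_lbound [set l (x, u) + psi (f (x, u)) | u in controls Z x].
Proof.
move=> [b psi_b]; have [b' l_b] := l_lb.
by exists (b' + b) => _ [u Zu <-]; rewrite lerD ?l_b ?psi_b//; apply: f_maps.
Qed.

Lemma bellman_le psi x u : bounded_below_on X psi -> Z (x, u) ->
  T psi x <= l (x, u) + psi (f (x, u)).
Proof.
by move=> psi_b Zu; apply: ge_inf; [exact: bellman_has_lbound | exists u].
Qed.

Lemma bellman_ge psi x a : X x ->
  (forall u, Z (x, u) -> a <= l (x, u) + psi (f (x, u))) -> a <= T psi x.
Proof.
move=> Xx age; apply: lb_le_inf; last by move=> _ [u Zu <-]; apply: age.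
by have [u Zu] := U_nonempty Xx; exists (l (x, u) + psi (f (x, u))), u.
Qed.

Lemma bellman_mono psi psi' x : bounded_below_on X psi ->
  (forall y, X y -> psi y <= psi' y) -> X x -> T psi x <= T psi' x.
Proof.
move=> psi_b le Xx; apply: bellman_ge => // u Zu.
by apply: le_trans (bellman_le psi_b Zu) _; rewrite lerD2l le//; apply: f_maps.
Qed.

(** The hypothesis relates the two functions on [X] only, so that the lemma also
    says that [T] ignores the values outside [X]. *)
Lemma bellman_shift psi psi' a x : bounded_below_on X psi ->
  (forall y, X y -> psi' y = psi y + a) -> X x -> T psi' x = T psi x + a.
Proof.
move=> psi_b eq Xx; apply: inf_image_shift; first exact: U_nonempty.
  exact: bellman_has_lbound.
by move=> u Zu; rewrite eq ?addrA//; apply: f_maps.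
Qed.

(** This is where compactness of [Z] enters: the limit of an increasing sequence of continuous functions need not be
    continuous, yet taking the minimum over the controls commutes with the
    limit.  Controls that are nearly optimal for [psi k] accumulate at some
    control; by monotonicity in [k] this one is nearly optimal for every
    [psi j], hence for the limit.  The reverse inequality is
    [bellman_mono]. *)
Lemma bellman_lim_le (psi : nat -> 'rV[R]_n -> R) psi_oo x v :
  compact Z -> {within Z, continuous f} -> {within Z, continuous l} ->
  (forall k, {within X, continuous (psi k)}) ->
  (forall j k y, X y -> (j <= k)%N -> psi j y <= psi k y) ->
  (forall y, X y -> psi k y @[k --> \oo] --> psi_oo y) ->
  bounded_below_on X psi_oo ->
  X x -> (forall k, T (psi k) x <= v) -> T psi_oo x <= v.
Proof.
move=> cZ fc lc psic psi_nd psi_cvg psi_oo_b Xx Tv; rewrite leNgt; apply/negP => vT.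
pose w := (v + T psi_oo x) / 2.
have vw : v < w by rewrite /w; lra.
have wT : w < T psi_oo x by rewrite /w; lra.
(* An approximate minimizer suffices, which avoids showing that the infimum is
   attained. *)
have near_opt k : exists u, Z (x, u) /\ l (x, u) + psi k (f (x, u)) < w.
  apply: contrapT => no; have := le_lt_trans (Tv k) vw; rewrite ltNge => /negP; apply.
  apply: bellman_ge => // u Zu; rewrite leNgt; apply/negP => lt; apply: no.
  by exists u.
have [u uP] := choice near_opt.
pose K := Z `&` (fst @^-1` [set x]).
have cK : compact K.
  apply: compact_closedI => //; apply: closed_comp => [z _|]; first exact: cvg_fst.
  by apply: compact_closed; [exact: norm_hausdorff | exact: compact_set1].
have [[x' u'] [[Z' /= x'x] cl]] : K `&` cluster ((x, u k) @[k --> \oo]) !=set0.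
  apply: (cK ((x, u k) @[k --> \oo])).
  have KE : \forall k \near \oo, K (x, u k).
    by apply: nearW => k; split => //; exact: (uP k).1.
  exact: KE.
rewrite {x'}x'x in Z' cl.
suff: T psi_oo x <= w by rewrite leNgt wT.
apply: le_trans (bellman_le psi_oo_b Z') _.
have Xf := f_maps Z'.
have cvgj : l (x, u') + psi k (f (x, u')) @[k --> \oo] -->
    l (x, u') + psi_oo (f (x, u')).
  by apply: cvgD; [exact: cvg_cst | exact: psi_cvg].
rewrite -(cvg_lim _ cvgj)//; apply: limr_le; first by apply/cvg_ex; eexists; exact: cvgj.
(* For fixed [j], all the controls [u k] with [k >= j] satisfy the bound for
   [psi j]; a strict violation at the cluster point would persist nearby. *)
apply: nearW => j; rewrite leNgt; apply/negP => gtw.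
have /subspace_continuousP gc : {within Z, continuous (l + (psi j \o f))}.
  by apply: within_continuousD => //; apply: within_continuous_compose (psic j).
have /cvgr_gt /(_ _ gtw) gtw_near := gc _ Z'; rewrite near_withinE in gtw_near.
have ge_j : ((x, u k) @[k --> \oo]) [set z | exists2 k, (j <= k)%N & z = (x, u k)].
  by exists j => // k /= jk; exists k.
have [_ [[k jk ->]]] := cl _ _ ge_j gtw_near.
have [Zu lt] := uP k => /(_ Zu); rewrite ltNge => /negP; apply.
by apply: le_trans (ltW lt); rewrite lerD2l psi_nd//; apply: f_maps.
Qed.

(** * Relaxed value iteration *)

(** Moving at least half of the way, but never beyond, from [psi k] towards
    [T (psi k) - c] keeps the sequence increasing.  It also bounds the residual
    [T (psi k) - c - psi k] by twice the increment, so boundedness alone forces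
    the residual to vanish in the limit. *)
Lemma relaxed_value_iteration_cvg (psi : nat -> 'rV[R]_n -> R) (c : R) :
  compact Z -> {within Z, continuous f} -> {within Z, continuous l} ->
  (forall k, {within X, continuous (psi k)}) ->
  bounded_below_on X (psi 0%N) ->
  (forall k x, X x -> psi k x <= T (psi k) x - c) ->
  (forall k x, X x -> psi k x + (T (psi k) x - c - psi k x) / 2 <= psi k.+1 x) ->
  (forall k x, X x -> psi k.+1 x <= T (psi k) x - c) ->
  (forall x, X x -> has_ubound (range (psi ^~ x))) ->
  exists psi_oo : 'rV[R]_n -> R,
    [/\ forall x, X x -> psi k x @[k --> \oo] --> psi_oo x,
        forall k x, X x -> psi k x <= psi_oo x,
        bounded_below_on X psi_oo &
        forall x, X x -> T psi_oo x = psi_oo x + c].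
Proof.
move=> cZ fc lc psic psi0_b sub half le psi_ub.
have psi_nd j k y : X y -> (j <= k)%N -> psi j y <= psi k y.
  move=> Xy; apply: (@nondecreasing_seqP _ _ (psi ^~ y)).1 => i.
  by have := half i y Xy; have := sub i y Xy; lra.
pose psi_oo y := limn (psi ^~ y).
have cvg_oo y : X y -> psi k y @[k --> \oo] --> psi_oo y.
  move=> Xy; apply: nondecreasing_is_cvgn; last exact: psi_ub.
  by move=> j k; apply: psi_nd.
have le_oo k y : X y -> psi k y <= psi_oo y.
  move=> Xy; apply: (nondecreasing_cvgn_le (u_ := psi ^~ y)).
    by move=> i j; apply: psi_nd.
  by apply/cvg_ex; eexists; exact: cvg_oo.
have psi_b k : bounded_below_on X (psi k).
  by have [b hb] := psi0_b; exists b => y Xy; apply: le_trans (hb _ Xy) (psi_nd _ _ _ Xy _).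
have oo_b : bounded_below_on X psi_oo.
  by have [b hb] := psi0_b; exists b => y Xy; apply: le_trans (hb _ Xy) (le_oo _ _ Xy).
exists psi_oo; split => // x Xx; apply/eqP; rewrite eq_le; apply/andP; split.
  apply: (bellman_lim_le cZ fc lc psic psi_nd cvg_oo oo_b Xx) => k.
  (* The half step gives [T (psi i) x - c <= 2 * psi i.+1 x - psi i x]; the
     bound at the fixed index [k] follows by monotonicity of [T] and [i -> oo]. *)
  have cvg2 : 2 * psi i.+1 x - psi i x @[i --> \oo] --> 2 * psi_oo x - psi_oo x.
    apply: cvgB; last exact: cvg_oo.
    by apply: cvgMr; have := cvg_oo _ Xx; rewrite -cvg_shiftS.
  rewrite -lerBlDr (_ : psi_oo x = 2 * psi_oo x - psi_oo x); last by lra.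
  rewrite -(cvg_lim _ cvg2)//; apply: limr_ge.
    by apply/cvg_ex; eexists; exact: cvg2.
  near=> i; have ki : (k <= i)%N by near: i; exact: nbhs_infty_ge.
  have := half i _ Xx.
  have : T (psi k) x <= T (psi i) x.
    by apply: bellman_mono => // y Xy; apply: psi_nd.
  by lra.
(* The upper bound on [psi k.+1] passes to the limit by monotonicity of [T]. *)
rewrite -lerBrDr; apply: limr_le; first by apply/cvg_ex; eexists; exact: cvg_oo.
near=> k; have k0 : (0 < k)%N by near: k; exact: nbhs_infty_gt.
rewrite -(prednK k0); apply: le_trans (le _ _ Xx) _.
by rewrite lerD2r; apply: bellman_mono => // y Xy; apply: le_oo.
Unshelve. all: by end_near. Qed.

(** * Min-shifted Bellman steps *)

(** The invariant of the min-shifted iteration.  The offset [a] accounts for the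
    fact that an iterate sinks below [- lambda], by the same amount at all points
    of [N]. *)
Definition admissible (lambda : 'rV[R]_n -> R) (c : R) (N : set 'rV[R]_n)
    (phi : 'rV[R]_n -> R) : Prop :=
  [/\ {within X, continuous phi},
      forall x, X x -> phi x + c <= T phi x &
      exists a, (forall x, X x -> a - lambda x <= phi x) /\
                (forall x, N x -> phi x = a - lambda x)].

Section MinShifted.
Variables (lambda : 'rV[R]_n -> R) (c : R) (N : set 'rV[R]_n).
Hypothesis X_compact : compact X.
Hypothesis T_cont : forall psi : 'rV[R]_n -> R, {within X, continuous psi} ->
  {within X, continuous (T psi)}.
Hypothesis lambda_cont : {within X, continuous lambda}.
Hypothesis N_nonempty : N !=set0.
Hypothesis N_sub : N `<=` X.
Hypothesis T_on_N : forall psi : 'rV[R]_n -> R,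
  (forall x, X x -> - lambda x <= psi x) ->
  (forall x, N x -> psi x = - lambda x) ->
  forall x, N x -> T psi x = c - lambda x.

Lemma admissible_bounded_below phi : admissible lambda c N phi ->
  bounded_below_on X phi.
Proof. by case=> phic _ _; exact: within_continuous_compact_lbound phic. Qed.

Lemma admissible_opp_lambda :
  (forall x u, Z (x, u) -> lambda (f (x, u)) <= lambda x + l (x, u) - c) ->
  admissible lambda c N (fun x => - lambda x).
Proof.
move=> storage; split.
- move=> x; apply: (@continuousN _ _ (subspace X) lambda); exact: lambda_cont.
- move=> x Xx; apply: bellman_ge => // u Zu.
  by have := storage _ _ Zu; lra.
- by exists 0; split => x _; rewrite sub0r.
Qed.

(** The hypothesis on [N] applies to [phi] lowered by its offset, and [T]
    commutes with additive constants. *)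
Lemma admissible_bellman_on phi x : admissible lambda c N phi -> N x ->
  T phi x = phi x + c.
Proof.
move=> adm Nx; have phi_b := admissible_bounded_below adm.
case: adm => _ _ [a [age aeq]].
have e : T (fun y => phi y - a) x = c - lambda x.
  apply: T_on_N => // y; first by move=> /age; lra.
  by move=> /aeq; lra.
have := bellman_shift (psi' := fun y => phi y - a) (a := - a) phi_b
  (fun _ _ => erefl) (N_sub Nx).
by rewrite e aeq//; lra.
Qed.

(** The maximum of [phi - T phi] is known exactly: this difference is at most
    [- c] everywhere and equal to [- c] on [N].  Thus only the minimum varies with
    [phi], and [s] is half of the largest residual [T phi - c - phi]. *)
Lemma shift_const_admissible phi : admissible lambda c N phi ->
  exists s, [/\ 0 <= s, shift_const X phi (T phi) = - c - s &
    forall x, X x -> T phi x - c - phi x <= 2 * s].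
Proof.
move=> adm; have [x0 Nx0] := N_nonempty; have Xx0 := N_sub Nx0.
have Tx0 := admissible_bellman_on adm Nx0.
have [phic sub _] := adm.
set D := [set phi x - T phi x | x in X].
have Dc : D (- c) by exists x0 => //; rewrite Tx0; lra.
have supD : sup D = - c.
  have ubD : ubound D (- c) by move=> _ [x Xx <-]; have := sub x Xx; lra.
  apply/eqP; rewrite eq_le; apply/andP; split; first by apply: ge_sup => //; exists (- c).
  by apply: ub_le_sup => //; exists (- c).
have lbD : has_lbound D.
  have [b hb] := within_continuous_compact_lbound X_compact
    (within_continuousB phic (T_cont phic)).
  by exists b => _ [x Xx <-]; exact: hb.
have inf_le d : D d -> inf D <= d by move=> Dd; apply: ge_inf.
exists ((- c - inf D) / 2); split.
- by have := inf_le _ Dc; lra.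
- by rewrite /shift_const -/D supD; lra.
- by move=> x Xx; have := inf_le _ (ex_intro2 _ _ x Xx erefl); lra.
Qed.

(** Both arguments of the minimum are at least [phi - s], and on [N] the second
    one equals it, so the offset drops by [s].  The step satisfies
    [T phi' >= T phi - s >= phi' + c] because it never exceeds
    [T phi - c - s]. *)
Lemma min_shifted_bellman_admissible phi : admissible lambda c N phi ->
  admissible lambda c N (min_shifted_bellman X Z f l phi) /\
  exists2 s, 0 <= s & forall x, X x ->
    min_shifted_bellman X Z f l phi x = Num.min (phi x) (T phi x - c - s) /\
    T phi x - c - phi x <= 2 * s.
Proof.
move=> adm; have phi_b := admissible_bounded_below adm.
have [s [s0 sE s2]] := shift_const_admissible adm.
have stepE x : min_shifted_bellman X Z f l phi x = Num.min (phi x) (T phi x - c - s).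
  by rewrite /min_shifted_bellman sE addrA.
split; last by exists s => // x Xx; split; [exact: stepE | exact: s2].
have TN := fun x => @admissible_bellman_on phi x adm.
case: adm => phic sub [a [age aeq]].
have ge x : X x -> phi x - s <= min_shifted_bellman X Z f l phi x.
  by move=> Xx; rewrite stepE le_min; apply/andP; have := sub x Xx; lra.
split.
- have -> : min_shifted_bellman X Z f l phi = phi \min (T phi + cst (- c - s)).
    by apply/funext => x; rewrite stepE/= addrA.
  move=> x; apply: (@continuous_min _ (subspace X)); first exact: phic.
  by apply: within_continuousD; [exact: T_cont | move=> y; exact: cvg_cst].
- move=> x Xx.
  have : T (fun y => phi y - s) x <= T (min_shifted_bellman X Z f l phi) x.
    apply: bellman_mono => //.
    by have [b hb] := phi_b; exists (b - s) => y Xy; rewrite lerD2r hb.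
  rewrite (bellman_shift (a := - s) phi_b)//; apply: le_trans.
  by rewrite stepE -lerBrDr ge_min orbC; apply/orP; left; lra.
- exists (a - s); split => x.
    by move=> Xx; have := ge x Xx; have := age x Xx; lra.
  move=> Nx; rewrite stepE TN// aeq//.
  by case: lerP; lra.
Qed.

Lemma iter_admissible phi k : admissible lambda c N phi ->
  admissible lambda c N (iter k (min_shifted_bellman X Z f l) phi).
Proof.
by move=> adm; elim: k => //= k IH; have [] := min_shifted_bellman_admissible IH.
Qed.

End MinShifted.
End BellmanOperator.

Arguments admissible {R n m} X Z f l lambda c N phi.

(** * Normalization *)

Lemma normalize_shift (R : realType) (n : nat) (X : set 'rV[R]_n)
    (phi psi : 'rV[R]_n -> R) (a : R) (x : 'rV[R]_n) :
  bounded_below_on X psi -> (forall y, X y -> phi y = psi y + a) -> X x ->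
  normalize X phi x = normalize X psi x.
Proof.
move=> [b hb] eq Xx; rewrite /normalize (inf_image_shift (a := a) _ _ eq).
- by rewrite eq//; lra.
- by exists x.
- by exists b => _ [y Xy <-]; exact: hb.
Qed.

Lemma inf_nondecreasing_is_cvgn (R : realType) (T : Type) (A : set T)
    (psi : nat -> T -> R) (g : T -> R) :
  A !=set0 ->
  (exists b, forall t, A t -> b <= psi 0%N t) ->
  (forall k t, A t -> psi k t <= psi k.+1 t) ->
  (forall k t, A t -> psi k t <= g t) ->
  cvgn (fun k => inf [set psi k t | t in A]).
Proof.
move=> [t0 At0] [b hb] nd psi_g.
have lb k : has_lbound [set psi k t | t in A].
  exists b => _ [t At <-].
  by elim: k => [|k IH]; [exact: hb | exact: le_trans IH (nd k t At)].
have inf_le k t : A t -> inf [set psi k t | t in A] <= psi k t.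
  by move=> At; apply: ge_inf; [exact: lb | exists t].
apply: nondecreasing_is_cvgn.
  apply/nondecreasing_seqP => k; apply: lb_le_inf; first by exists (psi k.+1 t0), t0.
  by move=> _ [t At <-]; exact: le_trans (inf_le k t At) (nd k t At).
by exists (g t0) => _ [k _ <-]; exact: le_trans (inf_le k t0 At0) (psi_g k t0 At0).
Qed.

Unset Implicit Arguments.

(** * Convergence of the normalized iterates *)

Theorem theorem6p8 (R : realType) (n m : nat)
    (X : set 'rV[R]_n) (Z : set ('rV[R]_n * 'rV[R]_m))
    (f : 'rV[R]_n * 'rV[R]_m -> 'rV[R]_n) (l : 'rV[R]_n * 'rV[R]_m -> R)
    (X_nonempty : X !=set0)
    (X_compact : compact X)
    (Z_sub : forall x u, Z (x, u) -> X x)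
    (Z_compact : compact Z)
    (f_cont : {within Z, continuous f})
    (f_maps : forall z, Z z -> X (f z))
    (l_cont : {within Z, continuous l})
    (U_nonempty : forall x, X x -> controls Z x !=set0)
    (U_usc : usc_setmap X (controls Z))
    (T_cont : forall psi : 'rV[R]_n -> R, {within X, continuous psi} ->
       {within X, continuous (bellman Z f l psi)})
    (lambda : 'rV[R]_n -> R) (c : R)
    (lambda_cont : {within X, continuous lambda})
    (lambda_storage : forall x u, Z (x, u) ->
       lambda (f (x, u)) <= lambda x + l (x, u) - c)
    (N_exists : exists N : set 'rV[R]_n,
       [/\ N !=set0, N `<=` X &
         forall psi : 'rV[R]_n -> R,
           (forall x, X x -> - lambda x <= psi x) ->
           (forall x, N x -> psi x = - lambda x) ->
           forall x, N x -> bellman Z f l psi x = c - lambda x])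
    (T_bounded : exists2 M : R, 0 < M &
       forall (k : nat) x, X x ->
         iter k (bellman Z f l) (fun y => - lambda y) x <= M + c * k%:R) :
  exists psi_oo : 'rV[R]_n -> R,
    (forall x, X x ->
       (fun k : nat => normalize X
          (iter k (min_shifted_bellman X Z f l) (fun y => - lambda y)) x)
         @ \oo --> psi_oo x) /\
    shifted_bellman_solution X Z f l psi_oo.
Proof.
have [N [[x0 Nx0] N_sub N_turn]] := N_exists.
have Xx0 := N_sub _ Nx0.
have [M _ TM] := T_bounded.
have l_lb := within_continuous_compact_lbound Z_compact l_cont.
pose S := min_shifted_bellman X Z f l.
pose phi k := iter k S (fun y => - lambda y).
have adm k : admissible X Z f l lambda c N (phi k).
  apply: iter_admissible => //; first by exists x0.
  exact: admissible_opp_lambda.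
have phi_b k := admissible_bounded_below X_compact (adm k).
(* The value at a point of [N] is the right constant to subtract: it drops by
   exactly the [s] of each step, which turns the step into a relaxed one. *)
pose psi k x := phi k x + - phi k x0.
have psi_b k : bounded_below_on X (psi k).
  by have [b hb] := phi_b k; exists (b + - phi k x0) => x Xx; rewrite lerD2r hb.
have Tpsi k x : X x -> bellman Z f l (psi k) x = bellman Z f l (phi k) x + - phi k x0.
  by move=> Xx; apply: (bellman_shift f_maps l_lb U_nonempty (phi_b k)).
have psi_sub k x : X x -> psi k x <= bellman Z f l (psi k) x - c.
  by move=> Xx; have [_ sub _] := adm k; have := sub x Xx; rewrite Tpsi// /psi; lra.
have step k x : X x ->
    psi k x + (bellman Z f l (psi k) x - c - psi k x) / 2 <= psi k.+1 x
      <= bellman Z f l (psi k) x - c.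
  move=> Xx.
  have [_ [s s0 sP]] := min_shifted_bellman_admissible f_maps l_lb U_nonempty X_compact
    T_cont (ex_intro _ x0 Nx0) N_sub N_turn (adm k).
  have Tx0 := admissible_bellman_on f_maps l_lb U_nonempty X_compact N_sub N_turn
    (adm k) Nx0.
  have [Ex Dx] := sP x Xx; have [Ex0 _] := sP x0 Xx0.
  have sx := psi_sub k x Xx.
  rewrite Tpsi// /psi in sx *.
  rewrite -[phi k.+1]/(min_shifted_bellman X Z f l (phi k)) Ex Ex0 Tx0.
  by case: (lerP (phi k x)); case: (lerP (phi k x0)); lra.
(* The relaxed iteration is slower than value iteration, whose growth is
   controlled by [T_bounded]. *)
have psi_T k x : X x -> psi k x <=
    iter k (bellman Z f l) (fun y => - lambda y) x - c * k%:R + lambda x0.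
  elim: k x => [|k IH] x Xx; first by rewrite /psi /phi /=; lra.
  have /andP[_ le] := step k x Xx; apply: le_trans le _.
  set v := iter k (bellman Z f l) (fun y => - lambda y) in IH.
  have v_b : bounded_below_on X v.
    have [b hb] := psi_b k; exists (b + (c * k%:R - lambda x0)) => y Xy.
    by have := hb y Xy; have := IH y Xy; lra.
  have : bellman Z f l (psi k) x
         <= bellman Z f l (fun y => v y + (lambda x0 - c * k%:R)) x.
    apply: (bellman_mono f_maps l_lb U_nonempty (psi_b k)) => // y Xy.
    by have := IH y Xy; lra.
  rewrite (bellman_shift f_maps l_lb U_nonempty v_b (fun _ _ => erefl))// -/v iterS -/v.
  by rewrite -natr1; lra.
have [||psi_oo [cvg_oo le_oo oo_b oo_eq]] :=
  relaxed_value_iteration_cvg (psi := psi) f_maps l_lb U_nonempty Z_compact f_cont l_cont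
   _ (psi_b 0%N) psi_sub (fun k x Xx => (andP (step k x Xx)).1)
   (fun k x Xx => (andP (step k x Xx)).2).
- move=> k; have [phic _ _] := adm k.
  by apply: within_continuousD => // y; exact: cvg_cst.
- move=> x Xx; exists (M + lambda x0) => _ [k _ <-].
  by have := psi_T k x Xx; have := TM k x Xx; lra.
have /cvg_ex[/= b b_cvg] : cvgn (fun k => inf [set psi k y | y in X]).
  apply: (inf_nondecreasing_is_cvgn X_nonempty (psi_b 0%N) _ le_oo) => k x Xx.
  by have /andP[h _] := step k x Xx; have := psi_sub k x Xx; lra.
exists (fun x => psi_oo x - b); split.
  move=> x Xx.
  have -> : (fun k => normalize X (phi k) x) = (fun k => normalize X (psi k) x).
    apply/funext => k; apply: (normalize_shift (a := phi k x0)) => // y _.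
    by rewrite /psi; lra.
  by apply: cvgB; [exact: cvg_oo | exact: b_cvg].
split; first by have [d hd] := oo_b; exists (d - b) => x Xx; rewrite lerD2r hd.
exists c => x Xx.
rewrite (bellman_shift f_maps l_lb U_nonempty (a := - b) oo_b)// oo_eq//; lra.
Qed.
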